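(* Let $(C_\alpha)_{\alpha\in A}$ be a net of random closed sets in $E$, $C_\alpha$ being defined on a probability space $(\Omega_\alpha,\mathcal{A}_\alpha,\mathbb{P}_\alpha)$, and let $C$ be a random closed set in $E$ on a probability space $(\Omega,\mathcal{A},\mathbb{P})$. Assume that $C_\alpha \stackrel{\mathcal{D}}{\rightarrow} C$ in $(\mathcal{F},\tau_{uF})$ and that $(\xi_\alpha)$ is a net of measurable selections $\xi_\alpha$ of $C_\alpha$. If $(\xi_\alpha)$ is asymptotically tight, then $\xi_\alpha \stackrel{\mathcal{D}}{\rightarrow} C$. In case that $C \subseteq \{\xi\}$ $\mathbb{P}$-a.s. for some random variable $\xi$ in $E$ on $(\Omega,\mathcal{A},\mathbb{P})$ we obtain: $\xi_\alpha \stackrel{\mathcal{D}}{\rightarrow} \xi$ in $(E,\mathcal{G})$.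
   Context: $(E,\mathcal{G})$ is a non-empty locally compact, second-countable Hausdorff space with Borel $\sigma$-algebra $\mathcal{B}(E)$; $\mathcal{G}$ is the family of its open sets, and $\mathcal{F}$ and $\mathcal{K}$ are the families of all closed and all compact subsets of $E$. For $A\subseteq E$ put $\mathcal{M}(A)=\{F\in\mathcal{F}: F\cap A=\emptyset\}$ and $\mathcal{H}(A)=\{F\in\mathcal{F}: F\cap A\neq\emptyset\}$. The Fell topology $\tau_F$ on $\mathcal{F}$ is generated by $\{\mathcal{M}(K):K\in\mathcal{K}\}\cup\{\mathcal{H}(G):G\in\mathcal{G}\}$; the upper Fell topology $\tau_{uF}$ on $\mathcal{F}$ is generated by $\{\mathcal{M}(K):K\in\mathcal{K}\}$. Their Borel $\sigma$-algebras coincide: $\mathcal{B}_F:=\sigma(\tau_F)=\sigma(\tau_{uF})$. Weak convergence: for a topological space $(X,\mathcal{O})$ and a net $(P_\alpha)_{\alpha\in A}$ ($A$ a directed set) of probability measures and a probability measure $P$ on $(X,\sigma(\mathcal{O}))$, $P_\alpha\rightarrow_w P$ on $(X,\mathcal{O})$ means convergence in the weak topology (the initial topology with respect to the maps $P\mapsto P(O)$, $O\in\mathcal{O}$, into $\mathbb{R}$ with the topology $\{(a,\infty):a\in\mathbb{R}\}\cup\{\emptyset,\mathbb{R}\}$); equivalently, $\liminf_\alpha P_\alpha(O)\ge P(O)$ for all $O\in\mathcal{O}$; equivalently, $\limsup_\alpha P_\alpha(F)\le P(F)$ for all closed sets $F$ of $(X,\mathcal{O})$. A random closed set in $E$ on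 a probability space $(\Omega,\mathcal{A},\mathbb{P})$ is an $\mathcal{A}$-$\mathcal{B}_F$ measurable map $C:\Omega\to\mathcal{F}$. A random variable in $E$ is a measurable map into $(E,\mathcal{B}(E))$. $C_\alpha \stackrel{\mathcal{D}}{\rightarrow} C$ in $(\mathcal{F},\tau_{uF})$ means $\mathbb{P}_\alpha\circ C_\alpha^{-1}\rightarrow_w \mathbb{P}\circ C^{-1}$ on $(\mathcal{F},\tau_{uF})$; $\xi_\alpha \stackrel{\mathcal{D}}{\rightarrow} \xi$ in $(E,\mathcal{G})$ means $\mathbb{P}_\alpha\circ \xi_\alpha^{-1}\rightarrow_w \mathbb{P}\circ \xi^{-1}$ on $(E,\mathcal{G})$. A measurable selection of $C_\alpha$ is a random variable $\xi_\alpha$ in $E$ on $(\Omega_\alpha,\mathcal{A}_\alpha,\mathbb{P}_\alpha)$ with $\xi_\alpha\in C_\alpha$ $\mathbb{P}_\alpha$-a.s. The net $(\xi_\alpha)$ is asymptotically tight if for every $\epsilon>0$ there exists a $K\in\mathcal{K}$ with $\liminf_\alpha\mathbb{P}_\alpha(\xi_\alpha\in K)\ge 1-\epsilon$. Convergence in distribution to a random closed set, $\xi_\alpha \stackrel{\mathcal{D}}{\rightarrow} C$, means $\limsup_\alpha\mathbb{P}_\alpha(\xi_\alpha\in F)\le T_C(F)$ for all $F\in\mathcal{F}$, where $T_C(F)=\mathbb{P}(C\cap F\neq\emptyset)$ is the capacity functional of $C$. ''$C\subseteq D$ $\mathbb{P}$-a.s.'' means that $\{\omega: C(\omega)\nsubseteq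 D(\omega)\}$ is a $\mathbb{P}$-null set (outer measure zero). *)

(* Defs.v *)
From HB Require Import structures.
From mathcomp Require Import all_boot all_order all_algebra.
From mathcomp Require Import all_classical all_reals all_analysis.

Set Implicit Arguments.
Unset Strict Implicit.
Unset Printing Implicit Defensive.

Import Order.TTheory GRing.Theory Num.Theory.
Import numFieldNormedType.Exports.

Local Open Scope classical_set_scope.
Local Open Scope ring_scope.
Local Open Scope ereal_scope.

Record directed (A : Type) (le : A -> A -> Prop) : Prop := Directed {
  directed_nonempty : exists a : A, True;
  directed_refl : forall a, le a a;
  directed_trans : forall a b c, le a b -> le b c -> le a c;
  directed_ub : forall a b, exists c, le a c /\ le b c
}.

Definition tails (A : Type) (le : A -> A -> Prop) : set_system A :=
  filter_from [set: A] (fun a => [set b | le a b]).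

Definition net_limsup (A : Type) (le : A -> A -> Prop) (R : realType)
    (x : A -> \bar R) : \bar R :=
  ereal_inf [set ereal_sup [set x b | b in [set b | le a b]] | a in [set: A]].

Definition net_liminf (A : Type) (le : A -> A -> Prop) (R : realType)
    (x : A -> \bar R) : \bar R :=
  ereal_sup [set ereal_inf [set x b | b in [set b | le a b]] | a in [set: A]].

Definition borelType (X : ptopologicalType) : measurableType (@open X).-sigma :=
  g_sigma_algebraType (@open X).

(* The real line with the open sets ]a, +oo[, the empty set and the whole line;
   an alias of R, so that the usual topology of R is not picked up. *)
Definition ray_topology (R : realType) : Type := R.

Section ray_topology.
Variable R : realType.

HB.instance Definition _ := Choice.on (ray_topology R).

Definition ray_open : set_system (ray_topology R) :=
  [set `]a, +oo[%classic | a in [set: R]] `|` [set set0; setT].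

Let ray_openT : ray_open setT. Proof. by right; right. Qed.

Let ray_openI : setI_closed ray_open.
Proof.
move=> A B [[a _ <-]|[->|->]]; last 2 first.
- by move=> _; rewrite set0I; right; left.
- by rewrite setTI.
move=> [[b _ <-]|[->|->]].
- left; exists (Num.max a b) => //.
  by apply/seteqP; split=> x /=; rewrite !in_itv/= !andbT gt_max => /andP.
- by rewrite setI0; right; left.
- by rewrite setIT; left; exists a.
Qed.

Let ray_open_bigU (I : Type) (f : I -> set (ray_topology R)) :
  (forall i, ray_open (f i)) -> ray_open (\bigcup_i f i).
Proof.
move=> fo; set U := \bigcup_i f i.
have Uup (x y : R) : U x -> (x <= y)%R -> U y.
  move=> [i _ fix_] xy; exists i => //; move: fix_.
  case: (fo i) => [[a _ <-]|[->|->]]//=.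
  by rewrite !in_itv/= !andbT => /lt_le_trans; apply.
have Ulow (x : R) : U x -> U = setT \/ exists2 y : R, U y & (y < x)%R.
  move=> [i _ ]; case: (fo i) => [[a _ fa]|[->//|fa]] fix_.
    right; move: fix_; rewrite -fa/= in_itv/= andbT => ax.
    exists ((a + x) / 2)%R; last by rewrite midf_lt.
    by exists i => //; rewrite -fa/= in_itv/= andbT midf_lt.
  by left; apply/seteqP; split=> // y _; exists i => //; rewrite fa.
have [->|/set0P[u Uu]] := eqVneq U set0; first by right; left.
have [->|UT] := pselect (U = setT); first by right; right.
have [z zU] : exists z : R, ~ U z.
  by apply/existsNP => h; apply: UT; apply/seteqP; split=> // y _; exact: h.
have Uz (x : R) : U x -> (z <= x)%R.
  by move=> Ux; rewrite leNgt; apply/negP => /ltW xz; exact/zU/(Uup x).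
have hiU : has_inf (U : set R) by split; [exists u|exists z].
left; exists (inf (U : set R)) => //; apply/seteqP; split=> x /=.
  rewrite in_itv/= andbT => /(@inf_lt _ (U : set R) x); case; first by exists u.
  by move=> y Uy /ltW yx; exact: Uup yx.
rewrite in_itv/= andbT => Ux; have [//|[y Uy yx]] := Ulow _ Ux.
by apply: le_lt_trans yx; exact: (ge_inf hiU.2).
Qed.

HB.instance Definition _ := isOpenTopological.Build (ray_topology R)
  ray_openT ray_openI ray_open_bigU.

End ray_topology.

Definition eval_open (X : ptopologicalType) (R : realType)
    (O : {O : set X | open O}) (P : probability (borelType X) R) :
    ray_topology R :=
  fine (P (sval O)).

(* The initial topology of the maps P |-> P O, for O open in X; the values P O
   are finite, so `fine` loses nothing. *)
Definition weak_topology (X : ptopologicalType) (R : realType) :=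
  sup_topology (fun O : {O : set X | open O} =>
    Topological.class (initial_topology (@eval_open X R O))).

Definition weak_cvg (A : Type) (le : A -> A -> Prop) (X : ptopologicalType)
    (R : realType) (P_ : A -> probability (borelType X) R)
    (P : probability (borelType X) R) : Prop :=
  fmap P_ (tails le) --> (P : weak_topology X R).

Definition cvg_in_distribution (A : Type) (le : A -> A -> Prop)
    (X : ptopologicalType) (R : realType) (d_ : A -> measure_display)
    (Omega_ : forall a, measurableType (d_ a))
    (P_ : forall a, probability (Omega_ a) R)
    (X_ : forall a, {RV (P_ a) >-> borelType X})
    (d : measure_display) (Omega : measurableType d) (P : probability Omega R)
    (x : {RV P >-> borelType X}) : Prop :=
  weak_cvg le (fun a => distribution (P_ a) (X_ a)) (distribution P x).

Record closedSet (E : topologicalType) := ClosedSet {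
  closedSet_set :> set E;
  closedSet_closed : closed closedSet_set
}.

HB.instance Definition _ (E : topologicalType) := gen_eqMixin (closedSet E).
HB.instance Definition _ (E : topologicalType) := gen_choiceMixin (closedSet E).
HB.instance Definition _ (E : topologicalType) :=
  isPointed.Build (closedSet E) (ClosedSet (@closed0 E)).

Definition miss (E : topologicalType) (A : set E) : set (closedSet E) :=
  [set F : closedSet E | F `&` A = set0].

Definition hit (E : topologicalType) (A : set E) : set (closedSet E) :=
  [set F : closedSet E | F `&` A !=set0].

(* [fell E] and [upper_fell E] are two copies of [closedSet E], each carrying the
   topology generated by the given subbase. *)
Definition fell (E : topologicalType) : Type := closedSet E.

HB.instance Definition _ (E : topologicalType) := Pointed.on (fell E).
HB.instance Definition _ (E : topologicalType) :=
  @isSubBaseTopological.Build (fell E) (set (closedSet E))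
    ([set miss K | K in compact] `|` [set hit G | G in open]) id.

Definition upper_fell (E : topologicalType) : Type := closedSet E.

HB.instance Definition _ (E : topologicalType) := Pointed.on (upper_fell E).
HB.instance Definition _ (E : topologicalType) :=
  @isSubBaseTopological.Build (upper_fell E) (set (closedSet E))
    [set miss K | K in compact] id.

(* The identity map, with respect to the Borel sigma-algebras of the two
   topologies. *)
Definition fell_to_upper (E : topologicalType)
  (F : borelType (fell E)) : borelType (upper_fell E) := F.

Lemma fell_to_upper_measurable (E : topologicalType) :
  measurable_fun setT (@fell_to_upper E).
Proof.
apply: (@measurability _ _ (borelType (fell E)) (borelType (upper_fell E))
  _ _ (@open (upper_fell E))) => //.
move=> _ [_ [D' D'sub <-] <-]; rewrite setTI.
apply: sub_sigma_algebra; exists D' => // B /D'sub [I sI IB].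
by exists I => // K /sI; rewrite !inE => -[K' cK' <-]; left; exists K'.
Qed.

HB.instance Definition _ (E : topologicalType) :=
  isMeasurableFun.Build _ _ _ _ (@fell_to_upper E)
    (@fell_to_upper_measurable E).

Section random_closed_set.
Context (R : realType) (E : ptopologicalType) (d : measure_display)
  (Omega : measurableType d) (P : probability Omega R).

Definition random_closed_set := {RV P >-> borelType (fell E)}.

(* The same map, whose law is then a probability on the Borel sets of the upper
   Fell topology. *)
Definition as_upper_fell (C : random_closed_set) :
  {RV P >-> borelType (upper_fell E)} := @fell_to_upper E \o C.

Definition capacity (C : random_closed_set) (F : set E) : \bar R :=
  P [set w | hit F (C w)].

Definition measurable_selection (C : random_closed_set)
    (xi : {RV P >-> borelType E}) : Prop :=
  {ae P, forall w, (C w : set E) (xi w)}.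

End random_closed_set.

Definition asymptotically_tight (A : Type) (le : A -> A -> Prop)
    (E : ptopologicalType) (R : realType) (d_ : A -> measure_display)
    (Omega_ : forall a, measurableType (d_ a))
    (P_ : forall a, probability (Omega_ a) R)
    (xi_ : forall a, {RV (P_ a) >-> borelType E}) : Prop :=
  forall eps : R, (0 < eps)%R -> exists K : set E, compact K /\
    (1 - eps)%:E <= net_liminf le (fun a => P_ a (xi_ a @^-1` K)).

Definition cvg_in_distribution_to_set (A : Type) (le : A -> A -> Prop)
    (E : ptopologicalType) (R : realType) (d_ : A -> measure_display)
    (Omega_ : forall a, measurableType (d_ a))
    (P_ : forall a, probability (Omega_ a) R)
    (xi_ : forall a, {RV (P_ a) >-> borelType E})
    (d : measure_display) (Omega : measurableType d) (P : probability Omega R)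
    (C : random_closed_set E P) : Prop :=
  forall F : set E, closed F ->
    net_limsup le (fun a => P_ a (xi_ a @^-1` F)) <= capacity C F.

(* Main.v *)
Require Import Defs.
From HB Require Import structures.
From mathcomp Require Import finmap.
From mathcomp Require Import all_boot all_order all_algebra.
From mathcomp Require Import all_classical all_reals all_analysis.
From mathcomp Require Import lra.

Import Order.TTheory GRing.Theory Num.Theory.

Local Open Scope classical_set_scope.
Local Open Scope ring_scope.

(** For [K] compact and [F] closed, [F `&` K] is compact, so
    missing [F `&` K] is an open condition in the upper Fell topology, and the
    convergence of the laws of [C_ a] bounds from above the limit of the
    probabilities that [C_ a] hits [F `&` K] by [capacity C (F `&` K)], hence
    by [capacity C F]. A selection [xi_ a] can be in [F] only if [C_ a] hits
    [F `&` K] or if [xi_ a] is outside [K] ([selection_hit_bound]), and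
    tightness makes the probability of the second event eventually as small as
    wanted. This is the convergence of [xi_] to [C].

    If moreover [C] is almost surely included in [[set xi]], then
    [capacity C F <= P (xi \in F)] for every closed [F]; taking complements
    gives the lower bounds on open sets that characterize weak convergence
    ([weak_cvgP]).

    Local compactness and second countability are used only to make
    [capacity C F] the measure of a measurable set: [F] is a countable union of
    compact sets ([fell_measurable_hit_closed]). *)

(** * Upper and lower limits of nets *)

Section nets.
Context {A : Type} {le : A -> A -> Prop}.

Lemma tails_filter : directed le -> Filter (tails le).
Proof.
move=> [[a0 _] _ tr ub]; apply: filter_from_filter; first by exists a0.
move=> a b _ _; have [c [ac bc]] := ub a b.
by exists c => // e ce; split; [exact: tr ac ce|exact: tr bc ce].
Qed.

Lemma net_limsup_lt_tails (R : realType) (x : A -> \bar R) (c : \bar R) :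
  (net_limsup le x < c)%E -> tails le [set b | (x b < c)%E].
Proof.
move=> /ereal_inf_lt[_ [a _ <-] ac]; exists a => // b ab.
by apply: le_lt_trans ac; apply: ereal_sup_ubound; exists b.
Qed.

Lemma net_liminf_gt_tails (R : realType) (x : A -> \bar R) (c : \bar R) :
  (c < net_liminf le x)%E -> tails le [set b | (c < x b)%E].
Proof.
move=> /ereal_sup_gt[_ [a _ <-] ac]; exists a => // b ab.
by apply: lt_le_trans ac _; apply: ereal_inf_lbound; exists b.
Qed.

Lemma net_limsup_le_tails (R : realType) (x : A -> \bar R) (c : \bar R) :
  tails le [set b | (x b <= c)%E] -> (net_limsup le x <= c)%E.
Proof.
move=> [a _ ac]; apply: ge_ereal_inf.
exists (ereal_sup [set x b | b in [set b | le a b]]); first by exists a.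
by apply: ge_ereal_sup => _ [b ab <-]; exact: ac.
Qed.

End nets.

(** * Measures and Borel sets *)

Lemma probability_fineE {d} {T : measurableType d} {R : realType}
    (Q : probability T R) {B : set T} :
  measurable B -> Q B = (fine (Q B))%:E.
Proof. by move=> mB; rewrite fineK//; exact: fin_num_measure. Qed.

Lemma le_measure_ae {d} {T : measurableType d} {R : realType}
    (mu : {measure set T -> \bar R}) (A B : set T) :
  measurable A -> measurable B -> {ae mu, forall w, A w -> B w} ->
  (mu A <= mu B)%E.
Proof.
move=> mA mB [N [mN N0 subN]].
rewrite -[leRHS]adde0 -N0; apply: (@le_trans _ _ (mu (B `|` N))).
  apply: le_measure; rewrite ?inE//; first exact: measurableU.
  move=> w Aw; have [Bw|nBw] := pselect (B w); [by left|right].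
  by apply: subN => /= /(_ Aw).
exact: measureU2.
Qed.

Lemma open_measurable_borel {E : ptopologicalType} {O : set E} : open O ->
  measurable (O : set (borelType E)).
Proof. exact: sub_sigma_algebra. Qed.

Lemma closed_measurable_borel {E : ptopologicalType} {F : set E} : closed F ->
  measurable (F : set (borelType E)).
Proof.
move=> cF; rewrite -[F]setCK; apply: (@measurableC _ (borelType E)).
by apply: open_measurable_borel; exact: closed_openC.
Qed.

(** * Weak convergence *)

Section weak_convergence.
Context {A : Type} {le : A -> A -> Prop} (le_directed : directed le).
Context {X : ptopologicalType} {R : realType}.
Variables (P_ : A -> probability (borelType X) R).
Variable (P : probability (borelType X) R).

Lemma ray_openE {U : set (ray_topology R)} {x : R} : open U -> U x ->
  U = setT \/ exists2 t : R, t < x & [set y | t < y] = U.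
Proof.
case=> [[t _ <-] /=|[->//|->]]; last by left.
rewrite in_itv/= andbT => tx; right; exists t => //.
by apply/seteqP; split=> y /=; rewrite in_itv/= andbT.
Qed.

(** The weak topology is initial for the evaluations at open sets, with values
    in the topology of upper rays, so that convergence only asks for
    lower bounds: this is liminf P_a(O) >= P(O), written without liminf. *)
Lemma weak_cvgP : weak_cvg le P_ P <->
  forall O : set X, open O -> forall t : R, (t%:E < P O)%E ->
    tails le [set a | (t%:E < P_ a O)%E].
Proof.
have F := tails_filter le_directed.
have fin (Q : probability (borelType X) R) (O : set X) : open O ->
    Q O = (fine (Q O))%:E.
  by move=> oO; apply: probability_fineE; exact: open_measurable_borel.
rewrite /weak_cvg; split.
- move=> /cvg_sup h O oO t tPO.
  apply: (h (exist _ O oO) [set Q : probability (borelType X) R |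
    (t%:E < Q O)%E]).
  apply: open_nbhs_nbhs; split => //.
  exists [set y | t < y].
    left; exists t => //.
    by apply/seteqP; split=> y /=; rewrite in_itv/= andbT.
  by apply/seteqP; split=> Q /=; rewrite /eval_open/= (fin Q)// lte_fin.
- move=> h; apply/cvg_sup => -[G oG] W; rewrite nbhsE => -[_ [[U oU <-] UP] UW].
  apply: filterS UW _ => /=.
  have [->|[t tP tU]] := ray_openE oU UP; first exact: filterT.
  have := h G oG t; rewrite (fin P G)// lte_fin => /(_ tP).
  apply: filterS => a /=.
  by rewrite (fin _ G)// lte_fin -tU.
Qed.
End weak_convergence.

(** * Hitting and missing sets *)

Section hit_miss.
Context {E : ptopologicalType}.

Lemma missE (A : set E) : @miss E A = ~` @hit E A.
Proof.
apply/seteqP; split=> F; rewrite /miss /hit /=.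
  by move=> ->; case.
by move=> /set0P/negP/negPn/eqP.
Qed.

Lemma upper_fell_open_miss {K : set E} : compact K ->
  open (@miss E K : set (upper_fell E)).
Proof.
move=> cK; exists [set @miss E K]; last by rewrite bigcup_set1.
move=> _ ->; exists [fset (@miss E K)]%fset.
  by move=> V /fset1P ->; rewrite inE; exists K.
by rewrite set_fset1 bigcap_set1.
Qed.

Lemma fell_measurable_hit_compact {K : set E} : compact K ->
  measurable (@hit E K : set (borelType (fell E))).
Proof.
move=> cK; rewrite -[hit K]setCK -missE.
apply: (@measurableC _ (borelType (fell E))).
have mK : measurable (@miss E K : set (borelType (upper_fell E))).
  by apply: sub_sigma_algebra; exact: upper_fell_open_miss.
exact: (measurable_funPTI (@fell_to_upper E) mK).
Qed.

(** The closures of the basic open sets that are relatively compact cover the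
    space. *)
Lemma locally_compact_sigma_compact :
  locally_compact [set: E] -> @second_countable E ->
  exists K : nat -> set E, (forall n, compact (K n)) /\ \bigcup_n K n = setT.
Proof.
move=> lcE [B /countable_injP[f finj] [_ Bnbhs]].
(* g is an enumeration of B: a left inverse on B of the injection f. *)
pose g n := xget set0 [set V | B V /\ f V = n].
exists (fun n => if `[<compact (closure (g n))>] then closure (g n) else set0).
split; first by move=> n; case: asboolP => // _; exact: compact0.
apply/seteqP; split=> // x _.
have [U + [cptU cU]] := lcE x I.
rewrite /within/= => nU.
have /Bnbhs[V [BV Vx] VU] : nbhs x U by apply: filterS nU => y; exact.
have gfV : g (f V) = V.
  have [BW fW] : [set W | B W /\ f W = f V] (g (f V)).
    by apply: xgetPex; exists V.
  by apply: finj; rewrite ?inE.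
exists (f V) => //; rewrite gfV.
case: asboolP => [_|]; first exact: subset_closure.
case; apply: (subclosed_compact _ cptU); first exact: closed_closure.
by rewrite [U](closure_id _).1//; exact: closureS.
Qed.

Lemma fell_measurable_hit_closed {F : set E} :
  locally_compact [set: E] -> @second_countable E -> closed F ->
  measurable (@hit E F : set (borelType (fell E))).
Proof.
move=> lcE scE cF; have [K [cK KT]] := locally_compact_sigma_compact lcE scE.
have -> : @hit E F = \bigcup_n @hit E (K n `&` F).
  apply/seteqP; split=> D /=.
    move=> [x [Dx Fx]]; have : setT x by []; rewrite -KT => -[n _ Knx].
    by exists n => //; exists x.
  by move=> [n _ [x [Dx [_ Fx]]]]; exists x.
apply: bigcupT_measurable => n; apply: fell_measurable_hit_compact.
exact: compact_closedI.
Qed.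

End hit_miss.

(** * Selections of random closed sets *)

(** If a selection [xi] of [C] lies in [F], then either [C] hits [K `&` F] or
    [xi] is outside [K]. *)
Lemma selection_hit_bound {R : realType} {E : ptopologicalType}
    {d : measure_display} {Omega : measurableType d} {P : probability Omega R}
    {C : random_closed_set E P} {xi : {RV P >-> borelType E}} {K F : set E} :
  measurable_selection C xi -> compact K -> closed K -> closed F ->
  (P (xi @^-1` F) <=
   P [set w | hit (K `&` F) (C w)] + P (~` (xi @^-1` K)))%E.
Proof.
move=> Cxi cptK cK cF.
have mK := measurable_funPTI xi (closed_measurable_borel cK).
have mF := measurable_funPTI xi (closed_measurable_borel cF).
have mH : measurable [set w | hit (K `&` F) (C w)].
  apply: (measurable_funPTI C); apply: fell_measurable_hit_compact.
  exact: compact_closedI.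
apply: le_trans (measureU2 _ _ _) => //; last exact: measurableC.
apply: le_measure_ae => //.
  by apply: measurableU => //; exact: measurableC.
apply: filterS Cxi => w Cxi Fxi.
have [Kxi|nKxi] := pselect (K (xi w)); [left|by right].
by exists (xi w).
Qed.

Theorem corollary4 (R : realType) (E : ptopologicalType)
  (E_lc : locally_compact [set: E])
  (E_sc : @second_countable E)
  (E_T2 : hausdorff_space E)
  (A : Type) (le : A -> A -> Prop) (le_directed : directed le)
  (d_ : A -> measure_display) (Omega_ : forall a, measurableType (d_ a))
  (P_ : forall a, probability (Omega_ a) R)
  (C_ : forall a, random_closed_set E (P_ a))
  (d : measure_display) (Omega : measurableType d) (P : probability Omega R)
  (C : random_closed_set E P)
  (C_cvg : cvg_in_distribution le (fun a => as_upper_fell (C_ a))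
             (as_upper_fell C))
  (xi_ : forall a, {RV (P_ a) >-> borelType E})
  (xi_sel : forall a, measurable_selection (C_ a) (xi_ a))
  (xi_tight : asymptotically_tight le xi_) :
  cvg_in_distribution_to_set le xi_ C /\
  (forall xi : {RV P >-> borelType E},
     {ae P, forall w, (C w : set E) `<=` [set xi w]} ->
     cvg_in_distribution le xi_ xi).
Proof.
have fltr := tails_filter le_directed.
have mhit (F : set E) : closed F -> measurable [set w | hit F (C w)].
  move=> cF.
  exact: (measurable_funPTI C (fell_measurable_hit_closed E_lc E_sc cF)).
have toC : cvg_in_distribution_to_set le xi_ C.
  move=> F cF; apply/lee_addgt0Pr => e e0.
  have e30 : 0 < e / 3 by lra.
  have [K [cptK tightK]] := xi_tight _ e30.
  have cK := compact_closed E_T2 cptK.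
  have cptKF : compact (K `&` F) by exact: compact_closedI.
  have cKF : closed (K `&` F) by exact: closedI.
  (* The tightness bound is on the liminf: to have it eventually, a second
     e / 3 is given up; the third one goes to the law of C. *)
  have evK : tails le [set a | ((1 - 2 * (e / 3))%:E < P_ a (xi_ a @^-1` K))%E].
    apply: net_liminf_gt_tails; apply: lt_le_trans tightK.
    by rewrite lte_fin; lra.
  have mhitKF := mhit _ cKF.
  have evC : tails le [set a |
      ((fine (P (~` [set w | hit (K `&` F) (C w)])) - e / 3)%:E <
       P_ a (~` [set w | hit (K `&` F) (C_ a w)]))%E].
    have /(weak_cvgP le_directed) := C_cvg.
    move=> /(_ _ (upper_fell_open_miss cptKF)).
    rewrite missE => /(_ (fine (P (~` [set w | hit (K `&` F) (C w)])) - e / 3)).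
    apply; rewrite -[ltRHS]/(P (~` [set w | hit (K `&` F) (C w)])).
    rewrite [ltRHS]probability_fineE; last exact: measurableC.
    by rewrite /= lte_fin; lra.
  apply: net_limsup_le_tails; apply: filterS2 evK evC => a /=.
  have mK : measurable (xi_ a @^-1` K).
    by apply: measurable_funPTI; exact: closed_measurable_borel.
  have mF : measurable (xi_ a @^-1` F).
    by apply: measurable_funPTI; exact: closed_measurable_borel.
  have mH : measurable [set w | hit (K `&` F) (C_ a w)].
    exact: (measurable_funPTI (C_ a)
      (fell_measurable_hit_compact cptKF)).
  have le2 : (P [set w | hit (K `&` F) (C w)] <= capacity C F)%E.
    apply: le_measure; rewrite ?inE//; first exact: mhit.
    by move=> w [x [Cx [_ Fx]]]; exists x.
  move: (selection_hit_bound (xi_sel a) cptK cK cF) le2.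
  rewrite !probability_setC// /capacity.
  rewrite (probability_fineE P mhitKF) (probability_fineE P (mhit _ cF)).
  rewrite (probability_fineE (P_ a) mK) (probability_fineE (P_ a) mF).
  rewrite (probability_fineE (P_ a) mH).
  rewrite -!EFinB -!EFinD/= !lee_fin !lte_fin; lra.
split=> // xi Cxi; apply/(weak_cvgP le_directed) => O oO t.
rewrite -[ltRHS]/(P (xi @^-1` O)) => tPO.
have mO : measurable (O : set (borelType E)) by exact: open_measurable_borel.
have cO : closed (~` O) by exact: open_closedC.
have mxO := measurable_funPTI xi mO.
have : (net_limsup le (fun a => P_ a (xi_ a @^-1` (~` O))) < (1 - t)%:E)%E.
  apply: le_lt_trans (toC _ cO) _.
  apply: (@le_lt_trans _ _ (P (~` (xi @^-1` O)))).
    apply: le_measure_ae; [exact: mhit|exact: measurableC|].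
    apply: filterS Cxi => w Cw [x [Cx Ox]].
    by rewrite /= -(Cw x Cx).
  move: tPO; rewrite probability_setC// (probability_fineE P mxO).
  by rewrite -EFinB !lte_fin; lra.
move=> /net_limsup_lt_tails; apply: filterS => a /=.
have mxa := measurable_funPTI (xi_ a) mO.
rewrite -[X in _ -> (_ < X)%E]/(P_ a (xi_ a @^-1` O)).
rewrite preimage_setC probability_setC// (probability_fineE (P_ a) mxa).
by rewrite -EFinB !lte_fin; lra.
Qed.
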